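(* Let $X$ be a L\'evy process with $X_0=0$ and suppose $b\ge 1$. Then neither $\overline{T}_b(r)$ nor $T^*_b(r)$ can be relatively stable in probability as $r\to 0$; that is, there is no finite non-stochastic function $C(r)>0$ such that $\overline{T}_b(r)/C(r)\to 1$ in probability as $r\to 0$, and there is no finite non-stochastic function $C(r)>0$ such that $T^*_b(r)/C(r)\to 1$ in probability as $r\to 0$.
   Context: $X$ is a real-valued L\'evy process. For $r\ge 0$, $$\overline{T}_b(r)=\inf\{t\ge 0: X_t>rt^b\},\qquad T^*_b(r)=\inf\{t\ge 0:|X_t|>rt^b\},$$ with $\inf\emptyset=+\infty$. The limit $r\to0$ is from above. *)

(* Defs.v *)
From HB Require Import structures.
From mathcomp Require Import all_boot all_order all_algebra.
From mathcomp Require Import all_classical all_reals all_analysis.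
Import Order.TTheory GRing.Theory Num.Theory.
Import numFieldNormedType.Exports.

Set Implicit Arguments.
Unset Strict Implicit.
Unset Printing Implicit Defensive.

Local Open Scope classical_set_scope.
Local Open Scope ring_scope.

Section Levy.
Context {R : realType} {d : measure_display} {T : measurableType d}.
Variable P : probability T R.

(* The product rule over all choices of Borel sets covers subfamilies, by
   taking B i = setT. *)
Definition mutually_independent (n : nat) (Y : 'I_n -> T -> R) : Prop :=
  forall B : 'I_n -> set R, (forall i, measurable (B i)) ->
    P (\bigcap_i (Y i @^-1` B i)) = (\prod_(i < n) P (Y i @^-1` B i))%E.

Definition cadlag (f : R -> R) : Prop :=
  (forall t, 0 <= t -> f x @[x --> t^'+] --> f t) /\
  (forall t, 0 < t -> cvg (f x @[x --> t^'-])).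

(* Time is [0, +oo[; the values X t for t < 0 are never constrained.  Continuity
   in probability follows from the fields below. *)
Record levy_process (X : R -> T -> R) : Prop := {
  levy_measurable : forall t, 0 <= t -> measurable_fun setT (X t) ;
  levy_start : {ae P, forall w, X 0 w = 0} ;
  levy_independent : forall (n : nat) (t : 'I_n.+1 -> R),
    (forall i, 0 <= t i) ->
    {homo t : i j / (i <= j)%N >-> i <= j} ->
    mutually_independent
      (fun i : 'I_n => X (t (lift ord0 i)) \- X (t (widen_ord (leqnSn n) i))) ;
  levy_stationary : forall s t (B : set R), 0 <= s -> 0 <= t -> measurable B ->
    P ((X (s + t) \- X s) @^-1` B) = P (X t @^-1` B) ;
  levy_cadlag : {ae P, forall w, cadlag (X ^~ w)}
}.

(* ereal_inf set0 = +oo, and 0 `^ b = 0 for b != 0. *)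
Definition passage_time (X : R -> T -> R) (b r : R) (w : T) : \bar R :=
  ereal_inf [set t%:E | t in [set t | 0 <= t /\ r * t `^ b < X t w]].

Definition abs_passage_time (X : R -> T -> R) (b r : R) (w : T) : \bar R :=
  ereal_inf [set t%:E | t in [set t | 0 <= t /\ r * t `^ b < `|X t w|]].

(* mu_ext P is the outer probability of P: it equals P on measurable sets.  It
   is needed because paths are cadlag only almost surely and P is not assumed
   complete, so a passage time need only be measurable up to a null set, while
   P itself is meaningless on non-measurable sets. *)
Definition cvg_in_probability_at0 (Y : R -> T -> \bar R) (l : R) : Prop :=
  forall eps : R, 0 < eps ->
    mu_ext P [set w | (eps%:E < `|Y r w - l%:E|)%E] @[r --> 0^'+] --> 0%E.

Definition relatively_stable_at0 (Y : R -> T -> \bar R) : Prop :=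
  exists C : R -> R, (forall r, 0 < r -> 0 < C r) /\
    cvg_in_probability_at0 (fun r w => Y r w * ((C r)^-1)%:E)%E 1.

End Levy.

(* Main.v *)
(* For [b >= 1] the boundary is superadditive: [r s^b + r u^b <= r (s + u)^b].
   Hence if neither the process nor its restart at time [s] crosses the boundary
   before time [a > s], the process does not cross before time [s + a].  The two
   events have the same probability by stationarity.  With [a = 3C/4] and
   [s = C/2], relative stability would make both crossings unlikely, so the
   passage time would exceed [5C/4] with probability close to 1.  The argument
   only uses that the identity and the absolute value are continuous and
   subadditive. *)
Require Import Defs.
From HB Require Import structures.
From mathcomp Require Import all_boot all_order all_algebra.
From mathcomp Require Import all_classical all_reals all_analysis.
From mathcomp Require Import measurable_realfun ring lra.
Import Order.TTheory GRing.Theory Num.Theory.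
Import numFieldNormedType.Exports.

Local Open Scope classical_set_scope.
Local Open Scope ring_scope.

(** * Real powers *)

(** Write [x^p = x * x^(p-1)]; since [p - 1 >= 0], replacing the base of the second factor by the
    larger [x + y] only increases each term. *)
Lemma powR_superadditive (R : realType) (x y p : R) :
  0 <= x -> 0 <= y -> 1 <= p -> x `^ p + y `^ p <= (x + y) `^ p.
Proof.
move=> x0 y0 p1; have p0 : 0 < p by exact: lt_le_trans p1.
have le u v : 0 <= u -> 0 <= v -> u * u `^ (p - 1) <= u * (u + v) `^ (p - 1).
  by move=> u0 v0; rewrite ler_wpM2l// ge0_ler_powR ?nnegrE ?subr_ge0//;
    rewrite ?addr_ge0 ?lerDl.
rewrite -(mulr_powRB1 x0 p0) -(mulr_powRB1 y0 p0).
rewrite -(mulr_powRB1 (addr_ge0 x0 y0) p0).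
rewrite mulrDl lerD ?le//.
by rewrite [x + y]addrC le.
Qed.

Lemma powR_cvg_right (R : realType) (x p : R) :
  0 <= x -> 0 < p -> u `^ p @[u --> x^'+] --> x `^ p.
Proof.
rewrite le_eqVlt => /predU1P[<- p0|x0 _].
  by rewrite powR0 ?gt_eqF//; exact: powR_cvg0.
apply: cvg_at_right_filter.
have /derivable1_diffP/differentiable_continuous :
    derivable (fun u : R => u `^ p) x 1.
  by apply: derivable_powR; rewrite in_itv/= x0.
exact.
Qed.

(** * Equality of joint laws from equality on boxes *)

Section joint_law.
Context {R : realType} {d : measure_display} {T : measurableType d}.
Variables (P : probability T R) (n : nat).

Let tuple_of (Y : 'I_n -> T -> R) w : n.-tuple R := [tuple Y i w | i < n].

Lemma measurable_mktuple (Y : 'I_n -> T -> R) :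
  (forall i, measurable_fun setT (Y i)) -> measurable_fun setT (tuple_of Y).
Proof.
move=> mY; apply/measurable_fun_tnthP => i.
rewrite [X in measurable_fun _ X](_ : _ = Y i)//.
by apply/funext => w /=; rewrite tnth_mktuple.
Qed.

(** Boxes form a pi-system that generates the sigma-algebra on tuples and contains the whole space,
    so two probability laws agreeing on boxes are equal. *)
Lemma joint_law_unique (Y Z : 'I_n -> T -> R) :
  (forall i, measurable_fun setT (Y i)) ->
  (forall i, measurable_fun setT (Z i)) ->
  (forall B : 'I_n -> set R, (forall i, measurable (B i)) ->
    P (\bigcap_i (Y i @^-1` B i)) = P (\bigcap_i (Z i @^-1` B i))) ->
  forall D : set (n.-tuple R), measurable D ->
    P (tuple_of Y @^-1` D) = P (tuple_of Z @^-1` D).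
Proof.
move=> mY mZ YZ D mD.
pose box (B : 'I_n -> set R) : set (n.-tuple R) :=
  \bigcap_i ((@tnth n R ^~ i) @^-1` B i).
pose G : set (set (n.-tuple R)) :=
  [set box B | B in [set B | forall i, measurable (B i)]].
have mbox B : (forall i, measurable (B i)) -> measurable (box B).
  move=> mB; apply: fin_bigcap_measurable => // i _.
  by rewrite -[_ @^-1` _]setTI; exact: measurable_tnth.
have GT : G setT.
  by exists (fun=> setT) => //; apply/seteqP; split.
have GI : setI_closed G.
  move=> _ _ [B mB <-] [C mC <-]; exists (fun i => B i `&` C i).
    by move=> i; exact: measurableI.
  by rewrite /box -bigcapI.
have mG : measurable = <<s G >>.
  apply/seteqP; split.
    apply: smallest_sub; first exact: smallest_sigma_algebra.
    (* A cylinder over coordinate [i] is the box whose other sides are [setT]. *)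
    move=> A; rewrite -bigcup_seq/= => -[i _ [C mC <-]].
    apply: sub_sigma_algebra; exists (fun j => if j == i then C else setT).
      by move=> j; case: ifP.
    rewrite setTI; apply/seteqP; split => v /=.
      by move=> /(_ i Logic.I) /=; rewrite eqxx.
    by move=> Cv j _ /=; case: eqP => // ->.
  apply: smallest_sub; first exact: sigma_algebra_measurable.
  by move=> _ [B mB <-]; exact: mbox.
pose fY : {mfun T >-> n.-tuple R} := HB.pack (tuple_of Y)
  (isMeasurableFun.Build _ _ _ _ (tuple_of Y) (measurable_mktuple _ mY)).
pose fZ : {mfun T >-> n.-tuple R} := HB.pack (tuple_of Z)
  (isMeasurableFun.Build _ _ _ _ (tuple_of Z) (measurable_mktuple _ mZ)).
have boxE (W : 'I_n -> T -> R) B :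
    tuple_of W @^-1` box B = \bigcap_i (W i @^-1` B i).
  by apply/seteqP; split => w /= + i => /(_ i); rewrite /= tnth_mktuple.
apply: (measure_unique G (fun=> setT) mG GI _ _ (distribution P fY)
  (distribution P fZ)) => //.
- by apply/seteqP; split => // x _; exists 0%N.
- by move=> _ [B mB <-]; have := YZ B mB; rewrite -!boxE.
- by move=> _; rewrite (le_lt_trans (probability_le1 _ _)) ?ltry.
Qed.

End joint_law.

(** * Grid increments and dyadic crossing events *)

Section grid.
Context {R : realType} {d : measure_display} {T : measurableType d}.
Variables (P : probability T R) (X : R -> T -> R).
Hypothesis HX : levy_process P X.

Definition grid_increment (s h : R) (i : nat) : T -> R :=
  X (s + i.+1%:R * h) \- X (s + i%:R * h).

Lemma measurable_grid_increment s h i :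
  0 <= s -> 0 <= h -> measurable_fun setT (grid_increment s h i).
Proof.
move=> s0 h0; apply: measurable_funB; apply: (levy_measurable HX);
  by rewrite addr_ge0// mulr_ge0.
Qed.

Lemma grid_increment_box n (s h : R) (B : 'I_n -> set R) :
  0 <= s -> 0 <= h -> (forall i, measurable (B i)) ->
  P (\bigcap_(i : 'I_n) (grid_increment s h i @^-1` B i)) =
    (\prod_(i < n) P (X h @^-1` B i))%E.
Proof.
move=> s0 h0 mB.
pose t (i : 'I_n.+1) : R := s + i%:R * h.
have t0 i : 0 <= t i by rewrite addr_ge0// mulr_ge0.
have tle : {homo t : i j / (i <= j)%N >-> i <= j}.
  by move=> i j ij; rewrite lerD2l ler_wpM2r// ler_nat.
have := levy_independent HX t0 tle mB.
rewrite /t /= => ->; apply: eq_bigr => i _.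
rewrite -(levy_stationary HX (s := s + i%:R * h) _ h0 (mB i))//.
  by rewrite /bump/= add1n -natr1 mulrDl mul1r addrA.
by rewrite addr_ge0// mulr_ge0.
Qed.

(** Independence factors the probability of a box, and stationarity turns each factor into one that
    depends on [h] but not on [s]. *)
Lemma grid_increment_law n (s h : R) (D : set (n.-tuple R)) :
  0 <= s -> 0 <= h -> measurable D ->
  P ((fun w => [tuple grid_increment s h i w | i < n]) @^-1` D) =
  P ((fun w => [tuple grid_increment 0 h i w | i < n]) @^-1` D).
Proof.
move=> s0 h0 mD.
apply: (joint_law_unique P n (fun i => grid_increment s h i)
  (fun i => grid_increment 0 h i)) => // [i|i|B mB].
- exact: measurable_grid_increment.
- exact: measurable_grid_increment.
- by rewrite !grid_increment_box.
Qed.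

(* Dyadic grids are nested, so the crossing events increase with [n]. *)
Definition grid_crossing (g c : R -> R) (s a : R) (n : nat) : set T :=
  [set w | exists k : 'I_(2 ^ n),
    c (k%:R * (a / 2 ^+ n)) < g (X (s + k%:R * (a / 2 ^+ n)) w - X s w)].

(** Only countably many times are inspected, so this event is measurable without any path
    regularity. *)
Definition dyadic_crossing (g c : R -> R) (s a : R) : set T :=
  \bigcup_n grid_crossing g c s a n.

Lemma grid_crossing_nondecreasing (g c : R -> R) (s a : R) :
  nondecreasing_seq (grid_crossing g c s a).
Proof.
apply/nondecreasing_seqP => n; apply/subsetPset => w [k kw].
have k2 : (k.*2 < 2 ^ n.+1)%N by rewrite expnS mul2n ltn_double.
exists (Ordinal k2) => /=.
suff -> : k.*2%:R * (a / 2 ^+ n.+1) = k%:R * (a / 2 ^+ n) by [].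
by rewrite -muln2 natrM exprS; field; rewrite expf_neq0.
Qed.

(** The partial sums of the increments telescope to [X (s + k * h) - X s]. The set itself does not
    involve [s], so a crossing event depends on [s] only through the law of the increments. *)
Definition crossing_tuples n (g c : R -> R) (h : R) : set (n.-tuple R) :=
  \bigcup_(k : 'I_n)
    [set v | c (k%:R * h) < g (\sum_(i < n | (i < k)%N) tnth v i)].

Lemma measurable_crossing_tuples n (g c : R -> R) (h : R) :
  continuous g -> measurable (crossing_tuples n g c h).
Proof.
move=> cg; apply: fin_bigcup_measurable => // k _.
have mS : measurable_fun setT (fun v : n.-tuple R =>
    g (\sum_(i < n | (i < k)%N) tnth v i)).
  apply: measurableT_comp; first exact: continuous_measurable_fun.
  under eq_fun do rewrite -big_filter.
  by apply: measurable_sum => i; exact: measurable_tnth.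
have := measurable_fun_ltr (measurable_cst (c (k%:R * h))) mS.
by move=> /(_ measurableT [set true] I); rewrite setTI.
Qed.

Lemma grid_crossingE (g c : R -> R) (s a : R) n :
  grid_crossing g c s a n =
  (fun w => [tuple grid_increment s (a / 2 ^+ n) i w | i < 2 ^ n]) @^-1`
    crossing_tuples (2 ^ n) g c (a / 2 ^+ n).
Proof.
set h := a / 2 ^+ n.
have sumE (k : 'I_(2 ^ n)) w :
    \sum_(i < 2 ^ n | (i < k)%N)
      tnth [tuple grid_increment s h i w | i < 2 ^ n] i =
    X (s + k%:R * h) w - X s w.
  under eq_bigr do rewrite tnth_mktuple.
  rewrite -(big_ord_widen _ (fun i : nat => grid_increment s h i w))//;
    last exact/ltnW/ltn_ord.
  rewrite -(big_mkord xpredT (fun i => grid_increment s h i w)).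
  by rewrite telescope_sumr// mul0r addr0.
apply/seteqP; split => w /=.
  by case=> k kw; exists k => //=; rewrite sumE.
by case=> k _ /=; rewrite sumE => kw; exists k.
Qed.

Lemma measurable_grid_crossing (g c : R -> R) (s a : R) n :
  continuous g -> 0 <= s -> 0 <= a -> measurable (grid_crossing g c s a n).
Proof.
move=> cg s0 a0; rewrite grid_crossingE -[_ @^-1` _]setTI.
apply: measurable_mktuple => //; last exact: measurable_crossing_tuples.
by move=> i; apply: measurable_grid_increment; rewrite // divr_ge0// exprn_ge0.
Qed.

Lemma measurable_dyadic_crossing (g c : R -> R) (s a : R) :
  continuous g -> 0 <= s -> 0 <= a -> measurable (dyadic_crossing g c s a).
Proof.
by move=> cg s0 a0; apply: bigcupT_measurable => n; exact: measurable_grid_crossing.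
Qed.

(** For each [n] the grid events started at [s] and at [0] have equal probability; continuity from
    below along the nested grids passes this to the union. *)
Lemma dyadic_crossing_law (g c : R -> R) (s a : R) :
  continuous g -> 0 <= s -> 0 <= a ->
  P (dyadic_crossing g c s a) = P (dyadic_crossing g c 0 a).
Proof.
move=> cg s0 a0.
have cvgP u : 0 <= u ->
    P \o grid_crossing g c u a @ \oo --> P (dyadic_crossing g c u a).
  move=> u0; apply: nondecreasing_cvg_mu.
  - by move=> n; exact: measurable_grid_crossing.
  - exact: measurable_dyadic_crossing.
  - exact: grid_crossing_nondecreasing.
have PE : P \o grid_crossing g c s a = P \o grid_crossing g c 0 a.
  apply/funext => n /=; rewrite !grid_crossingE grid_increment_law//.
    by rewrite divr_ge0// exprn_ge0.
  exact: measurable_crossing_tuples.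
apply: cvg_unique (cvgP 0 _) => //.
by rewrite -PE; exact: cvgP.
Qed.

End grid.

(** * From dyadic times to all times, path by path *)

Lemma near_right_itv (R : realType) (x : R) (Q : set R) :
  (\forall y \near x^'+, Q y) ->
  exists2 e : R, 0 < e & forall y, x < y < x + e -> Q y.
Proof.
case=> e /= e0 Qe; exists e => // y /andP[xy ye]; apply: Qe => //=.
by rewrite distrC gtr0_norm ?subr_gt0// ltrBlDl.
Qed.

Lemma dyadic_dense (R : realType) (a x y : R) : 0 <= x -> x < y -> y <= a ->
  exists n, exists k : 'I_(2 ^ n), x < k%:R * (a / 2 ^+ n) < y.
Proof.
move=> x0 xy ya; have a0 : 0 < a by lra.
(* Then [a / (y - x) < n + 1 <= 2 ^ n], so the mesh is smaller than [y - x]. *)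
pose n := Num.truncn (a / (y - x)).
have d0 : 0 < a / 2 ^+ n by rewrite divr_gt0// exprn_gt0.
have d1 : a / 2 ^+ n < y - x.
  rewrite ltr_pdivrMr ?exprn_gt0// mulrC -ltr_pdivrMr ?subr_gt0//.
  rewrite (lt_le_trans (truncnS_gt _))// -natrX ler_nat.
  exact: ltn_expl.
(* The first grid index strictly beyond [x]; it overshoots by at most one mesh, hence stays below
   [y]. *)
pose k := (Num.truncn (x / (a / 2 ^+ n))).+1.
have /andP[k1 k2] : k.-1%:R <= x / (a / 2 ^+ n) < k%:R.
  by rewrite truncn_itv// divr_ge0// ltW.
rewrite ltr_pdivrMr// in k2; rewrite ler_pdivlMr// in k1.
have ky : k%:R * (a / 2 ^+ n) < y.
  by rewrite /k -natr1 mulrDl mul1r; rewrite /k/= in k1; lra.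
have kn : (k < 2 ^ n)%N.
  rewrite -(ltr_nat R) natrX -(ltr_pM2r d0).
  by rewrite [ltRHS]mulrC divfK ?expf_neq0// (lt_le_trans ky).
by exists n, (Ordinal kn) => /=; rewrite k2.
Qed.

Section paths.
Context {R : realType} {d : measure_display} {T : measurableType d}.
Variables (X : R -> T -> R) (g : R -> R) (w : T).
Hypothesis Xr : forall t : R, 0 <= t -> X x w @[x --> t^'+] --> X t w.
Hypothesis cg : continuous g.

(** By right-continuity of the path and of the boundary, a strict crossing at [u < a] persists just
    to the right of [u], where there is a dyadic time before [a]. *)
Lemma le_of_no_dyadic_crossing (c : R -> R) (s a : R) :
  (forall u : R, 0 <= u -> c v @[v --> u^'+] --> c u) ->
  0 <= s -> ~ dyadic_crossing X g c s a w ->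
  forall u, 0 <= u < a -> g (X (s + u) w - X s w) <= c u.
Proof.
move=> cc s0 nX u /andP[u0 ua]; rewrite leNgt; apply/negP => cu.
have su0 : 0 <= s + u by rewrite addr_ge0.
(* The midpoint separates the boundary from the path near [u]. *)
pose m := (c u + g (X (s + u) w - X s w)) / 2.
have gX : g (X x w - X s w) @[x --> (s + u)^'+] --> g (X (s + u) w - X s w).
  apply: (@cvg_comp _ _ _ (fun x => X x w - X s w) g _ _ _ _ (cg _)).
  by apply: cvgB; [exact: Xr|exact: cvg_cst].
have /near_right_itv[e e0 He] :
    \forall x \near (s + u)^'+, m < g (X x w - X s w).
  by apply: (cvgr_gt _ gX); rewrite /m; lra.
have /near_right_itv[e' e'0 He'] : \forall v \near u^'+, c v < m.
  by apply: (cvgr_lt _ (cc _ u0)); rewrite /m; lra.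
have [n [k /andP[uk ke]]] : exists n, exists k : 'I_(2 ^ n),
    u < k%:R * (a / 2 ^+ n) < Num.min a (u + Num.min e e').
  apply: dyadic_dense => //; last by rewrite ge_min lexx.
  by rewrite lt_min ua ltrDl lt_min e0.
move: ke; rewrite lt_min => /andP[_ ]; rewrite -ltrBlDl lt_min => /andP[ke ke'].
apply: nX; exists n => //; exists k.
by rewrite (lt_trans (He' _ _)) ?He//; lra.
Qed.

Lemma no_crossing_concat (b r s a : R) :
  (forall x y, g (x + y) <= g x + g y) -> 1 <= b -> 0 <= r ->
  0 <= s < a -> X 0 w = 0 ->
  ~ dyadic_crossing X g (fun t => r * t `^ b) 0 a w ->
  ~ dyadic_crossing X g (fun t => r * t `^ b) s a w ->
  forall t, 0 <= t < s + a -> g (X t w) <= r * t `^ b.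
Proof.
move=> gD b1 r0 /andP[s0 sa] X0 n0 ns t /andP[t0 tsa].
have cc u : 0 <= u -> r * v `^ b @[v --> u^'+] --> r * u `^ b.
  move=> u0; apply: cvgMr; apply: powR_cvg_right => //; lra.
have le0 u : 0 <= u < a -> g (X u w) <= r * u `^ b.
  by move=> /(le_of_no_dyadic_crossing _ _ _ cc (lexx 0) n0); rewrite add0r X0 subr0.
have [ta|at_] := ltP t a; first by rewrite le0// t0.
(* For [a <= t < s + a], split [X t] as [(X t - X s) + X s]: the restarted path is controlled at
   time [t - s], the original one at [s < a]. *)
have us : 0 <= t - s < a by lra.
have := le_of_no_dyadic_crossing _ _ _ cc s0 ns _ us.
rewrite [s + _]addrC subrK => gts.
rewrite -(subrK (X s w) (X t w)) (le_trans (gD _ _))//.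
have gs : g (X s w) <= r * s `^ b by apply: le0; rewrite s0.
have ts0 : 0 <= t - s by lra.
rewrite (le_trans (lerD gts gs))// -mulrDr ler_wpM2l//.
by have := powR_superadditive _ _ _ _ ts0 s0 b1; rewrite subrK.
Qed.

End paths.

(** * The contradiction with relative stability *)

Section not_relatively_stable.
Context {R : realType} {d : measure_display} {T : measurableType d}.
Variables (P : probability T R) (X : R -> T -> R).
Hypothesis HX : levy_process P X.

Definition hitting_time (g : R -> R) (b r : R) (w : T) : \bar R :=
  ereal_inf [set t%:E | t in [set t | 0 <= t /\ r * t `^ b < g (X t w)]].

Lemma not_relatively_stable_hitting_time (g : R -> R) (b : R) :
  continuous g -> (forall x y, g (x + y) <= g x + g y) -> 1 <= b ->
  ~ relatively_stable_at0 P (hitting_time g b).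
Proof.
move=> cg gD b1 [C [C0 Ccvg]].
(* Any tolerance below [1/4] would do: the ratio to [C r] will be below [3/4] or at least [5/4]. *)
pose E r := [set w |
  ((8^-1)%:E < `|hitting_time g b r w * ((C r)^-1)%:E - 1%:E|)%E].
have {Ccvg} EP : mu_ext P (E r) @[r --> 0^'+] --> 0%E.
  by apply: Ccvg; rewrite invr_gt0.
have [N [mN PN NX]] : {ae P, forall w, X 0 w = 0 /\ cadlag (X ^~ w)}.
  by apply: filterS2 (levy_start HX) (levy_cadlag HX) => w; split.
(* The bound [1/3] is used because, up to a null set, three events of outer probability at most that
   of [E r] will cover the space. *)
have [r [r0 Er]] : exists r, 0 < r /\ (mu_ext P (E r) < (3^-1)%:E)%E.
  have e0 : 0 < 3^-1 :> R by rewrite invr_gt0.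
  have Esmall : \forall r \near 0^'+, (mu_ext P (E r) < (3^-1)%:E)%E.
    have lt0 : (0 < (3^-1)%:E :> \bar R)%E by rewrite lte_fin.
    exact: EP _ (open_ereal_lt' lt0).
  have [r ?] := filter_ex (filterI (nbhs_right_gt 0) Esmall).
  by exists r.
(* These choices give [s < a < C r < s + a]. *)
pose a := 3 / 4 * C r; pose s := C r / 2.
have Cr := C0 r r0.
have a0 : 0 < a by rewrite /a; lra.
have s0 : 0 <= s by rewrite /s; lra.
pose A u := dyadic_crossing X g (fun t => r * t `^ b) u a.
have mA u : 0 <= u -> measurable (A u).
  by move=> u0; apply: (measurable_dyadic_crossing P) => //; exact: ltW.
have far w :
    (hitting_time g b r w < a%:E \/ (s + a)%:E <= hitting_time g b r w)%E -> E r w.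
  have : (0 <= hitting_time g b r w)%E.
    by apply: le_ereal_inf_tmp => _ [t [t0 _] <-]; rewrite lee_fin.
  rewrite /E /=; case: (hitting_time g b r w) => [y| |]//; last first.
    (* A path that never crosses has infinite hitting time, which also lies in [E r]. *)
    by move=> _ _; rewrite gt0_mulye ?lte_fin ?invr_gt0// addye// gee0_abs// ltry.
  rewrite -EFinM -EFinB abse_EFin lee_fin !lte_fin lee_fin => y0 ya.
  have yC : y = y / C r * C r by rewrite divfK// gt_eqF.
  set z := y / C r in yC *.
  have : z < 3 / 4 \/ 5 / 4 <= z.
    case: ya; rewrite {}yC /s /a => yC; [left|right].
      by rewrite -(ltr_pM2r Cr).
    by rewrite -(ler_pM2r Cr); lra.
  by case=> z1; [rewrite ltr0_norm|rewrite gtr0_norm]; lra.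
have early w : X 0 w = 0 -> A 0 w -> E r w.
  move=> X0 [n _ [k]]; rewrite add0r X0 subr0 => Xk; apply: far; left.
  set u := k%:R * (a / 2 ^+ n) in Xk.
  have ua : u < a.
    rewrite /u mulrCA gtr_pMr// ltr_pdivrMr ?exprn_gt0// mul1r.
    by rewrite -natrX ltr_nat.
  apply: (@le_lt_trans _ _ u%:E); last by rewrite lte_fin.
  apply: ereal_inf_lbound; exists u => //; split => //.
  by rewrite /u mulr_ge0// divr_ge0 ?exprn_ge0// ltW.
have late w : X 0 w = 0 -> cadlag (X ^~ w) -> ~ A 0 w -> ~ A s w -> E r w.
  move=> X0 [Xr _] n0 ns; apply: far; right.
  apply: le_ereal_inf_tmp => _ [t [t0 Xt] <-]; rewrite lee_fin leNgt.
  apply/negP => tsa; move: Xt; apply/negP; rewrite -leNgt.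
  have sa : 0 <= s < a by rewrite /s /a; lra.
  apply: (no_crossing_concat _ _ _ Xr cg b r s a gD b1 (ltW r0) sa X0 n0 ns).
  by rewrite t0.
have NE w : ~ N w -> X 0 w = 0 /\ cadlag (X ^~ w).
  by move=> Nw; apply: contrapT => h; apply: Nw; exact: NX.
have eN : mu_ext P N = 0%E by rewrite measurable_mu_extE.
have A0E : (mu_ext P (A 0%R) <= mu_ext P (E r))%E.
  rewrite -[leRHS]add0e -eN; apply: le_trans (outer_measureU2 _ _ _).
  apply: le_outer_measure => w Aw; have [|/NE[X0 _]] := pselect (N w); first by left.
  by right; exact: early.
(* [A s] need not lie in [E r]; it is bounded only through its probability, which equals that of
   [A 0]. *)
have AsE : (mu_ext P (A s) <= mu_ext P (E r))%E.
  apply: le_trans A0E; rewrite (measurable_mu_extE P (mA _ s0)).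
  rewrite (measurable_mu_extE P (mA _ (lexx 0))).
  by rewrite [leLHS](dyadic_crossing_law P X HX _ _ _ _ cg s0 (ltW a0)).
have cover : setT `<=` N `|` (A 0 `|` (A s `|` E r)).
  move=> w _; have [Nw|/NE[X0 Xc]] := pselect (N w); first by left.
  have [A0w|nA0] := pselect (A 0 w); first by right; left.
  have [Asw|nAs] := pselect (A s w); first by right; right; left.
  by right; right; right; exact: late.
have : (1 <= mu_ext P (E r) + (mu_ext P (E r) + mu_ext P (E r)))%E.
  rewrite -(probability_setT P) -measurable_mu_extE//.
  apply: (le_trans (le_outer_measure _ _ _ cover)).
  apply: (le_trans (outer_measureU2 _ _ _)); rewrite [X in (X + _)%E]eN add0e.
  apply: (le_trans (outer_measureU2 _ _ _)); apply: leeD.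
    exact: A0E.
  apply: (le_trans (outer_measureU2 _ _ _)); apply: leeD; last by [].
  exact: AsE.
apply/negP; rewrite -ltNge.
have -> : 1%E = ((3^-1)%:E + ((3^-1)%:E + (3^-1)%:E))%E :> \bar R.
  by rewrite -!EFinD; congr (_%:E); lra.
by rewrite !lteD.
Qed.

End not_relatively_stable.

Theorem proposition3p1 (R : realType) (d : measure_display)
    (T : measurableType d) (P : probability T R) (X : R -> T -> R) (b : R)
    (HX : levy_process P X) (Hb : 1 <= b) :
  ~ relatively_stable_at0 P (passage_time X b) /\
  ~ relatively_stable_at0 P (abs_passage_time X b).
Proof.
split.
- apply: (not_relatively_stable_hitting_time P X HX id) => // x.
  exact: cvg_id.
- apply: (not_relatively_stable_hitting_time P X HX Num.norm) => //.
    exact: norm_continuous.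
  exact: ler_normD.
Qed.
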